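(* For all integers $1\le h\le n$, $$c_{n,h,h-1}^{(\lambda,\theta)}=(1-\theta)^h(\lambda\theta)^{n-1}(-\theta)^{n-h}\binom{2n}{n-h}\sum_{v=0}^{n-h}\frac{(h-n)_v(-n)_v}{(-2n)_v\,v!\,\theta^v}\;{}_2F_1\!\left(-v,-n,n-v+1;\tfrac1\lambda\right),$$ where ${}_2F_1(a,b,c;x)$ is the Gauss hypergeometric function. In particular, for any $n\ge1$ (and $1\le h\le n$), $$c_{n,h,h-1}^{(1,\theta)}=(1-\theta)^n\theta^{n-1}\binom{2n}{n-h}.$$
   Context: Fix $\lambda\in(0,1]$, $\theta\in(0,1)$. $(x)_N=x(x+1)\cdots(x+N-1)$ is the Pochhammer symbol. ${}_2F_1(a,b,c;x)=\sum_{i\ge0}\frac{(a)_i(b)_i}{(c)_i\,i!}x^i$ (here a terminating series). For integers $1\le h\le n$ and $0\le l\le n-1$ define polynomials in $d$, with coefficients that are polynomials in the variables $j,k$: $$P_{n,h}(j,k,d)=(d-2j-1)(d+2h-2j-1)(d-j)_h((1-\theta)d-j)_h(\lambda\theta d+h-n-j+k)_n(\theta d+h-n-j+k)_n,$$ $$D_{n,h,l}(j,k,d)=\lambda\theta\, d^{l+1}(d+h-2j-1)(\theta d-j)_h(d-n+h-2j-1+k)_{n+h+1}.$$ $Q_{n,h,l}(j,k,d)$ is the quotient in the polynomial long division, with respect to the variable $d$, of $P_{n,h}(j,k,d)$ by $D_{n,h,l}(j,k,d)$; it has degree $n-l-1$ in $d$ and is written $Q_{n,h,l}(j,k,d)=\sum_{i=0}^{n-l-1}q^{(n,h)}_{n-l-1-i}(j,k)d^i$,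 where the $q_i^{(n,h)}(j,k)$ are polynomials in $j,k$ not depending on $l$. For $0\le l\le h-1\le n-1$, $c_{n,h,l}^{(\lambda,\theta)}$ denotes the coefficient of the monomial $j^{h-l-1}k^{n-h}$ in $q_{n-l-1}^{(n,h)}(j,k)$. *)

(* Defs.v *)
From mathcomp Require Import all_boot all_order all_algebra.
From mathcomp Require Import boolp classical_sets reals topology normedtype.
From mathcomp Require Import sequences zify.

Set Implicit Arguments.
Unset Strict Implicit.
Unset Printing Implicit Defensive.

Import Order.TTheory GRing.Theory Num.Theory.
Import numFieldNormedType.Exports.

Local Open Scope ring_scope.

Definition pochhammer (A : nzRingType) (x : A) (N : nat) : A :=
  \prod_(i < N) (x + i%:R).

Definition hyp2F1 (R : realType) (a b c x : R) : R :=
  limn (series (fun i : nat =>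
    pochhammer a i * pochhammer b i / (pochhammer c i * i`!%:R) * x ^+ i)).

(* Polynomials in d with coefficients in R[k][j]: d is the outermost variable,
   then j, then k. *)
Definition polyjk (R : nzRingType) := {poly {poly R}}.
Definition polydjk (R : nzRingType) := {poly {poly {poly R}}}.

Section Polynomials.
Variables (R : realType) (lambda theta : R).
Implicit Types (n h l m : nat).

Local Notation d := ('X : polydjk R).
Local Notation j := ('X%:P : polydjk R).
Local Notation k := ('X%:P%:P : polydjk R).
Local Notation cst c := ((c : R)%:P%:P%:P : polydjk R).

Definition P_poly n h : polydjk R :=
  (d - 2%:R * j - 1) * (d + (2 * h)%:R - 2%:R * j - 1)
  * pochhammer (d - j) h
  * pochhammer (cst (1 - theta) * d - j) h
  * pochhammer (cst (lambda * theta) * d + h%:R - n%:R - j + k) n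
  * pochhammer (cst theta * d + h%:R - n%:R - j + k) n.

Definition D_poly n h l : polydjk R :=
  cst (lambda * theta) * d ^+ l.+1
  * (d + h%:R - 2%:R * j - 1)
  * pochhammer (cst theta * d - j) h
  * pochhammer (d - n%:R + h%:R - 2%:R * j - 1 + k) (n + h + 1).

(* [%/] is in general only a pseudo-division, but here the leading coefficient
   of the divisor is a unit, so this is the true quotient: see [PDE]. *)
Definition Q_poly n h l : polydjk R := P_poly n h %/ D_poly n h l.

(* Read off from the case l = 0; [Q_polyE] shows that the same coefficients
   work for every l. *)
Definition q_coef n h m : polyjk R := (Q_poly n h 0)`_(n - 1 - m).

Definition c_coef n h l : R := (q_coef n h (n - l - 1))`_(h - l - 1)`_(n - h).

Lemma lin_lead (a : R) (c : polyjk R) : a != 0 ->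
  size (cst a * d + c%:P) = 2 /\ lead_coef (cst a * d + c%:P) = a%:P%:P.
Proof.
move=> a0; have s1 : size (cst a * d) = 2%N.
  by rewrite size_Cmul ?size_polyX // !polyC_eq0.
have lt : (size c%:P < size (cst a * d)%R)%N.
  by rewrite s1 ltnS size_polyC leq_b1.
by rewrite size_polyDl // lead_coefDl // lead_coefM lead_coefC lead_coefX mulr1.
Qed.

Lemma poch_lead (a : R) (c : polyjk R) (N : nat) : a != 0 ->
  size (pochhammer (cst a * d + c%:P) N) = N.+1 /\
  lead_coef (pochhammer (cst a * d + c%:P) N) = (a ^+ N)%:P%:P.
Proof.
move=> a0.
have fE (i : 'I_N) : cst a * d + c%:P + i%:R = cst a * d + (c + i%:R)%:P.
  by rewrite -addrA polyCD polyC_natr.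
rewrite /pochhammer (eq_bigr _ (fun i _ => fE i)); split.
  rewrite size_prod => [|i _]; last first.
    by rewrite -size_poly_eq0 (lin_lead _ a0).1.
  under eq_bigr do rewrite (lin_lead _ a0).1.
  by rewrite sum_nat_const card_ord muln2 -addnn -addSn addnK.
rewrite lead_coef_prod; under eq_bigr do rewrite (lin_lead _ a0).2.
by rewrite prodr_const card_ord !polyC_exp.
Qed.

Lemma size_lead_mul (p q : polydjk R) (a b : R) (s t : nat) :
  a != 0 -> b != 0 ->
  size p = s.+1 /\ lead_coef p = a%:P%:P ->
  size q = t.+1 /\ lead_coef q = b%:P%:P ->
  size (p * q) = (s + t).+1 /\ lead_coef (p * q) = (a * b)%:P%:P.
Proof.
move=> a0 b0 [sp lp] [sq lq]; split; last by rewrite lead_coefM lp lq !polyCM.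
rewrite size_mul -?size_poly_eq0 ?sp ?sq //.
by rewrite addnS.
Qed.

Hypotheses (l0 : lambda != 0) (t0 : theta != 0) (t1 : 1 - theta != 0).

Lemma size_P n h : size (P_poly n h) = (2 * n + 2 * h + 3)%N.
Proof.
have dE : d = cst 1 * d by rewrite !polyC1 mul1r.
have f1 : d - 2%:R * j - 1 = cst 1 * d + (- (2%:R * 'X) - 1)%:P.
  by rewrite -dE rmorphB rmorphN rmorphM /= polyC1 polyC_natr addrA.
have f2 : d + (2 * h)%:R - 2%:R * j - 1
    = cst 1 * d + ((2 * h)%:R - 2%:R * 'X - 1)%:P.
  by rewrite -dE !rmorphB /= rmorphM /= polyC1 !polyC_natr !addrA.
have f3 : d - j = cst 1 * d + (- 'X)%:P by rewrite -dE rmorphN.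
have f4 : cst (1 - theta) * d - j = cst (1 - theta) * d + (- 'X)%:P.
  by rewrite rmorphN.
have f5 (a : R) : cst a * d + h%:R - n%:R - j + k
    = cst a * d + (h%:R - n%:R - 'X + 'X%:P)%:P.
  by rewrite rmorphD !rmorphB /= !polyC_natr !addrA.
rewrite /P_poly f1 f2 f4 !f5 f3.
have o : (1 : R) != 0 := oner_neq0 _.
have lt0 : lambda * theta != 0 by rewrite mulf_neq0.
have e1 := size_lead_mul o o (lin_lead (- (2%:R * 'X) - 1) o)
  (lin_lead ((2 * h)%:R - 2%:R * 'X - 1) o).
have e2 := size_lead_mul (mulf_neq0 o o) (expf_neq0 h o) e1
  (poch_lead (- 'X) h o).
have n2 := mulf_neq0 (mulf_neq0 o o) (expf_neq0 h o).
have e3 := size_lead_mul n2 (expf_neq0 h t1) e2 (poch_lead (- 'X) h t1).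
have n3 := mulf_neq0 n2 (expf_neq0 h t1).
have e4 := size_lead_mul n3 (expf_neq0 n lt0) e3
  (poch_lead (h%:R - n%:R - 'X + 'X%:P) n lt0).
have n4 := mulf_neq0 n3 (expf_neq0 n lt0).
have [-> _] := size_lead_mul n4 (expf_neq0 n t0) e4
  (poch_lead (h%:R - n%:R - 'X + 'X%:P) n t0).
by lia.
Qed.

Lemma size_lead_D n h l :
  size (D_poly n h l) = (n + 2 * h + l + 4)%N /\
  lead_coef (D_poly n h l) = (lambda * theta ^+ h.+1)%:P%:P.
Proof.
have dE : d = cst 1 * d by rewrite !polyC1 mul1r.
have f2 : d + h%:R - 2%:R * j - 1 = cst 1 * d + (h%:R - 2%:R * 'X - 1)%:P.
  by rewrite -dE !rmorphB /= rmorphM /= polyC1 !polyC_natr !addrA.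
have f3 : cst theta * d - j = cst theta * d + (- 'X)%:P by rewrite rmorphN.
have f4 : d - n%:R + h%:R - 2%:R * j - 1 + k
    = cst 1 * d + (- n%:R + h%:R - 2%:R * 'X - 1 + 'X%:P)%:P.
  rewrite -dE rmorphD !rmorphB !rmorphD rmorphN /= rmorphM /= polyC1.
  by rewrite !polyC_natr !addrA.
rewrite /D_poly f3 f4 f2.
have o : (1 : R) != 0 := oner_neq0 _.
have lt0 : lambda * theta != 0 by rewrite mulf_neq0.
have e1 : size (cst (lambda * theta) * d ^+ l.+1) = l.+2 /\
    lead_coef (cst (lambda * theta) * d ^+ l.+1) = (lambda * theta)%:P%:P.
  rewrite size_Cmul ?size_polyXn ?polyC_eq0 //.
  by rewrite lead_coefM lead_coefC lead_coefXn mulr1.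
have e2 := size_lead_mul lt0 o e1 (lin_lead (h%:R - 2%:R * 'X - 1) o).
have n2 := mulf_neq0 lt0 o.
have e3 := size_lead_mul n2 (expf_neq0 h t0) e2 (poch_lead (- 'X) h t0).
have n3 := mulf_neq0 n2 (expf_neq0 h t0).
have [-> ->] := size_lead_mul n3 (expf_neq0 (n + h + 1) o) e3
  (poch_lead (- n%:R + h%:R - 2%:R * 'X - 1 + 'X%:P) (n + h + 1) o).
split; last by rewrite expr1n !mulr1 exprS mulrA.
by lia.
Qed.

Lemma D_unit n h l : lead_coef (D_poly n h l) \is a GRing.unit.
Proof.
rewrite (size_lead_D n h l).2; do 2![apply: rmorph_unit].
by rewrite unitfE mulf_neq0 ?expf_neq0.
Qed.

Lemma PDE n h l :
  P_poly n h = Q_poly n h l * D_poly n h l + P_poly n h %% D_poly n h l /\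
  (size (P_poly n h %% D_poly n h l)%R < size (D_poly n h l))%N.
Proof.
split; first by apply: Pdiv.IdomainUnit.divp_eq; exact: D_unit.
by rewrite ltn_modp -size_poly_eq0 (size_lead_D n h l).1 addn4.
Qed.

Lemma size_Q n h l : size (Q_poly n h l) = (n - l)%N.
Proof.
rewrite size_divp -?size_poly_eq0 (size_lead_D n h l).1 ?addn4 //= size_P.
by lia.
Qed.

Lemma Q_polyE n h l : (l <= n - 1)%N ->
  Q_poly n h l = \poly_(i < n - l) q_coef n h (n - l - 1 - i).
Proof.
move=> ln; have D0 : D_poly n h l = D_poly n h 0 * d ^+ l.
  by rewrite /D_poly exprS expr1 mulrA -!mulrA; congr (_ * (_ * _));
    rewrite [LHS]mulrC -!mulrA.
set Q0 := Q_poly n h 0; set R0 := P_poly n h %% D_poly n h 0.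
have [PE sR] := PDE n h 0.
have -> : Q_poly n h l = drop_poly l Q0.
  rewrite /Q_poly; symmetry.
  apply: (Pdiv.IdomainUnit.divpP (D_unit n h l)
    (r := take_poly l Q0 * D_poly n h 0 + R0)).
    rewrite D0 addrA PE; congr (_ + _).
    rewrite -[LHS]/(Q0 * _) -[in LHS](poly_take_drop l Q0) mulrDl addrC.
    by rewrite -mulrA [d ^+ l * _]mulrC.
  have sD : size (D_poly n h l) = (size (D_poly n h 0) + l)%N.
    by rewrite !(size_lead_D _ _ _).1 addn0 addnAC.
  have D0p : (0 < size (D_poly n h 0))%N by rewrite (size_lead_D _ _ _).1 addn4.
  rewrite sD (leq_ltn_trans (size_polyD _ _)) // gtn_max; apply/andP; split.
    rewrite (leq_ltn_trans (size_polyMleq _ _)) //.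
    rewrite -(prednK D0p) addnS /= addSn ltnS addnC leq_add2l.
    exact: size_take_poly.
  by rewrite (leq_trans sR) // leq_addr.
apply/polyP => i; rewrite coef_drop_poly coef_poly.
case: ltnP => iln; last first.
  by apply: nth_default; rewrite size_Q; lia.
rewrite /q_coef -/Q0; by congr (_`_ _); lia.
Qed.
End Polynomials.

(* Main.v *)
Require Import Defs.
From mathcomp Require Import all_boot all_order all_algebra.
From mathcomp Require Import boolp classical_sets reals topology normedtype.
From mathcomp Require Import sequences ring zify.

Import Order.TTheory GRing.Theory Num.Theory.
Import numFieldNormedType.Exports.

Local Open Scope ring_scope.

Set Implicit Arguments.
Unset Strict Implicit.

(** The number c_(n,h,h-1) is the coefficient of d^(h-1) k^(n-h) in the quotient
    of P_(n,h) by D_(n,h,0).  Every factor of the dividend and of the divisor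
    is linear in d, j, k, and the quotient has total degree n - 1; so only the
    components of top total degree matter, and j may be set to 0.  With
    d := T and k := x T ([weight]), these components are, after the powers of T
    are dropped,
<<
      (1 - theta)^h (lambda theta + x)^n (theta + x)^n     for P,
      lambda theta^(h+1) (1 + x)^(n+h+1)                   for D.
>>
    The remainder has d-degree less than that of D, which makes it divisible
    by x^n in the relevant total degree ([coef_div_weight]).  Hence, by
    [c_coef_coef_div],
<<
      c_(n,h,h-1) = (1 - theta)^h / (lambda theta^(h+1))
        * [x^(n-h)] (lambda theta + x)^n (theta + x)^n / (1 + x)^(n+h+1).
>>
    Expanding the numerator by the binomial theorem and 1/(1+x)^(n+h+1) by the
    binomial series gives a double sum; its inner sum is the terminating 2F1
    ([bin_mul_hyp2F1]) and its outer coefficients are the ratios of Pochhammer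
    symbols ([bin_mul_pochhammer_ratio]).  For lambda = 1 the numerator is
    (theta + x)^(2n), and writing theta + x = theta (1 + x) + (1 - theta) x
    leaves a single term ([coef_div_shift_exp]). *)

(** * Coefficients of p / (1 + x)^N *)

(** The coefficient of x^m in the power series p / (1 + x)^N, spelled out
    through the binomial series.  The truncated predecessor makes the formula
    right for N = 0 as well, where (1 + x)^0 has the single nonzero coefficient
    'C(0, 0) = 1. *)
Definition coef_div {R : comNzRingType} (N m : nat) (p : {poly R}) : R :=
  \sum_(v < m.+1) p`_v * ((-1) ^+ (m - v) * 'C((N + (m - v)).-1, m - v)%:R).

(** Pascal's rule for the binomial series: it is what makes [coef_div] behave
    as a division by a power of 1 + x. *)
Lemma coef_divMl (R : comNzRingType) N m (p : {poly R}) :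
  coef_div N.+1 m ((1 + 'X) * p) = coef_div N m p.
Proof.
pose w K u : R := (-1) ^+ u * 'C((K + u).-1, u)%:R.
have wS u : w N.+1 u.+1 + w N.+1 u = w N u.+1.
  rewrite /w; have -> : (N.+1 + u.+1).-1 = (N + u).+1 by lia.
  have -> : (N.+1 + u).-1 = (N + u)%N by lia.
  by rewrite addnS /= binS natrD exprS; ring.
have w0 K : w K 0 = 1 by rewrite /w expr0 bin0 mul1r.
have wE K q : coef_div K m q = \sum_(v < m.+1) q`_v * w K (m - v)%N by [].
rewrite !wE; move: w wS w0 {wE} => w wS w0.
under eq_bigr => v _ do rewrite mulrDl mul1r coefD coefXM mulrDl.
rewrite big_split /= big_ord_recr [X in _ + X]big_ord_recl /= mul0r add0r.
rewrite subnn w0 addrAC -big_split [RHS]big_ord_recr /= subnn w0; congr (_ + _).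
apply: eq_bigr => v _; rewrite /bump /= add1n add0n -mulrDr; congr (_ * _).
by rewrite -(subnSK (ltn_ord v)) -wS.
Qed.

Lemma coef_div0 (R : comNzRingType) m (p : {poly R}) : coef_div 0 m p = p`_m.
Proof.
rewrite /coef_div big_ord_recr /= subnn expr0 bin0 mul1r mulr1 big1 ?add0r //.
by move=> v _; rewrite bin_small ?mulr0 //; have := ltn_ord v; lia.
Qed.

Lemma coef_div_expMl (R : comNzRingType) K N m (p : {poly R}) :
  coef_div (K + N) m ((1 + 'X) ^+ K * p) = coef_div N m p.
Proof.
by elim: K => [|K IH]; rewrite ?mul1r // addSn exprS -mulrA coef_divMl IH.
Qed.

Lemma coef_div_exp (R : comNzRingType) N m (p : {poly R}) :
  coef_div N m ((1 + 'X) ^+ N * p) = p`_m.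
Proof. by rewrite -[X in coef_div X]addn0 coef_div_expMl coef_div0. Qed.

Lemma eq_coef_div (R : comNzRingType) N m (p q : {poly R}) :
  (forall v, (v <= m)%N -> p`_v = q`_v) -> coef_div N m p = coef_div N m q.
Proof.
by move=> pq; apply: eq_bigr => v _; rewrite pq // -ltnS.
Qed.

Lemma coef_div_sum (R : comNzRingType) N m K (F : 'I_K -> {poly R}) :
  coef_div N m (\sum_i F i) = \sum_i coef_div N m (F i).
Proof.
rewrite /coef_div exchange_big; apply: eq_bigr => v _ /=.
by rewrite coef_sum mulr_suml.
Qed.

Lemma coef_divZ (R : comNzRingType) N m (a : R) (p : {poly R}) :
  coef_div N m (a *: p) = a * coef_div N m p.
Proof.
by rewrite /coef_div mulr_sumr; apply: eq_bigr => v _; rewrite coefZ -mulrA.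
Qed.

(** Expand (x + t)^N in powers of t (1 + x) and (1 - t) x.  After the division
    by (1 + x)^(N - m + 1), the i-th summand is x^i (1 + x)^(m - 1 - i) up to a
    scalar: for i < m this is a polynomial of degree m - 1, for i > m it starts
    beyond x^m, so that i = m alone contributes. *)
Lemma coef_div_shift_exp (R : comNzRingType) (t : R) N m : (m <= N)%N ->
  coef_div (N - m).+1 m (('X + t%:P) ^+ N)
  = 'C(N, m)%:R * (1 - t) ^+ m * t ^+ (N - m).
Proof.
move=> mN.
have -> : 'X + t%:P = t *: (1 + 'X) + (1 - t) *: 'X.
  by rewrite !scalerDr scalerBl scale1r -mul_polyC mulr1; ring.
rewrite exprDn coef_div_sum.
have term (i : 'I_N.+1) : coef_div (N - m).+1 m
    ((t *: (1 + 'X)) ^+ (N - i) * ((1 - t) *: 'X) ^+ i *+ 'C(N, i))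
    = (t ^+ (N - i) * (1 - t) ^+ i *+ 'C(N, i)) *
      coef_div (N - m).+1 m ((1 + 'X) ^+ (N - i) * 'X^i).
  by rewrite -coef_divZ !exprZn -scalerAl -scalerAr scalerA scalerMnl.
rewrite (eq_bigr _ (fun i _ => term i)) (bigD1 (Ordinal (mN : m < N.+1)%N)) //=.
rewrite [X in _ + X]big1 ?addr0 => [|i ineq].
  rewrite -addn1 coef_div_expMl /coef_div big_ord_recr /= coefXn eqxx subnn.
  rewrite big1 => [|v _]; last by rewrite coefXn ltn_eqF ?mul0r.
  by rewrite add0r expr0 bin0 !mulr1 -mulr_natl; ring.
have [im|mi] := ltnP i m; last first.
  rewrite /coef_div big1 ?mulr0 // => v _; rewrite coefMXn.
  rewrite ifT ?mul0r //; have := ltn_ord v.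
  have : (i : nat) != m by apply: contra ineq => /eqP e; apply/eqP/val_inj.
  by lia.
have -> : (N - i = (N - m).+1 + (m - i).-1)%N by lia.
rewrite [(1 + 'X) ^+ _]exprD -mulrA coef_div_exp coefMXn.
rewrite ifN -?leqNgt ?(ltnW im) //.
rewrite nth_default ?mulr0 //.
by rewrite addrC -[1]/(1%:P) -[1]opprK polyCN size_exp_XsubC; lia.
Qed.

(** * Pochhammer symbols and terminating 2F1 series *)

Lemma pochhammer_oppn (R : comNzRingType) (m v : nat) :
  pochhammer (- m%:R : R) v = (-1) ^+ v * (m ^_ v)%:R.
Proof.
rewrite /pochhammer; elim: v => [|v IH].
  by rewrite big_ord0 ffactn0 mulr1.
rewrite big_ord_recr IH /= ffactnSr natrM exprS.
have [vm|mv] := leqP v m; last by rewrite ffact_small // mulr0 !mul0r mulr0.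
by rewrite natrB //; ring.
Qed.

Lemma pochhammer_natS (R : comNzRingType) (m v : nat) :
  pochhammer (m%:R + 1 : R) v = ((m + v) ^_ v)%:R.
Proof.
rewrite /pochhammer; elim: v => [|v IH]; first by rewrite big_ord0 ffactn0.
by rewrite big_ord_recr IH /= addnS ffactSS natrM -addn1 !natrD; ring.
Qed.

Lemma ffactD n a b : (n ^_ (a + b) = n ^_ a * (n - a) ^_ b)%N.
Proof.
elim: b => [|b IH]; first by rewrite addn0 ffactn0 muln1.
by rewrite addnS !ffactnSr IH subnDA mulnA.
Qed.

(** Both sides, multiplied by (m - v)!, are the falling factorial of n of
    length m, cut after v factors on the right. *)
Lemma bin_mul_ffact n m v : (v <= m)%N ->
  ('C(n, m) * m ^_ v = n ^_ v * 'C(n - v, m - v))%N.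
Proof.
move=> vm; apply/eqP; rewrite -(eqn_pmul2r (fact_gt0 (m - v))) -!mulnA.
by rewrite ffact_fact // !bin_ffact -ffactD subnKC.
Qed.

(** Both sides, multiplied by (v - i)!, are the falling factorial of n of
    length v, cut after v - i factors on the right. *)
Lemma bin_mul_ffact_opp n v i : (i <= v <= n)%N ->
  ('C(n, v) * v ^_ i = 'C(n, v - i) * (n - v + i) ^_ i)%N.
Proof.
case/andP=> iv vn; apply/eqP.
rewrite -(eqn_pmul2r (fact_gt0 (v - i))) -!mulnA ffact_fact // bin_ffact.
rewrite [X in _ == (_ * X)%N]mulnC mulnA bin_ffact.
have -> : (n - v + i = n - (v - i))%N by lia.
by rewrite -ffactD subnK.
Qed.

Lemma hyp2F1_terminating (R : realType) (v : nat) (b c x : R) :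
  hyp2F1 (- v%:R) b c x = \sum_(i < v.+1)
    pochhammer (- v%:R) i * pochhammer b i / (pochhammer c i * i`!%:R) * x ^+ i.
Proof.
apply: norm_lim_near_cst; exists v.+1 => // N /= vN.
rewrite /series /= (big_cat_nat (leq0n v.+1) vN) //= big_mkord.
rewrite [X in _ + X]big_nat [X in _ + X]big1 ?addr0 //.
move=> i /andP[vi _].
by rewrite pochhammer_oppn ffact_small // mulr0 !mul0r.
Qed.

(** A 2F1 with these parameters is a Vandermonde-type convolution in disguise:
    the factor 'C(n, v) clears the denominators (n - v + 1)_i i! termwise. *)
Lemma bin_mul_hyp2F1 (R : realType) (n v : nat) (x : R) : (v <= n)%N ->
  'C(n, v)%:R * hyp2F1 (- v%:R) (- n%:R) (n%:R - v%:R + 1) x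
  = \sum_(i < v.+1) 'C(n, i)%:R * 'C(n, v - i)%:R * x ^+ i.
Proof.
move=> vn; rewrite hyp2F1_terminating mulr_sumr; apply: eq_bigr => i _.
have iv : (i <= v)%N by rewrite -ltnS.
rewrite -natrB // !pochhammer_oppn pochhammer_natS mulrA; congr (_ * _).
rewrite mulrACA -exprD addnn -mul2n exprM sqrrN expr1n expr1n mul1r mulrA.
apply: (canLR (mulfK _)).
  by rewrite mulf_neq0 // pnatr_eq0 -lt0n ?fact_gt0 // ffact_gt0; lia.
rewrite -!natrM; congr _%:R; rewrite mulnA bin_mul_ffact_opp ?iv //.
by rewrite -(bin_ffact n i); lia.
Qed.

(** The signs of the three Pochhammer symbols leave (-1)^v, and 'C(N, m) clears
    the denominator (-N)_v. *)
Lemma bin_mul_pochhammer_ratio (R : numFieldType) (N n m v : nat) :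
  (v <= m)%N -> (v <= N)%N ->
  'C(N, m)%:R * (pochhammer (- m%:R) v * pochhammer (- n%:R) v
    / (pochhammer (- N%:R) v * v`!%:R))
  = (-1) ^+ v * 'C(N - v, m - v)%:R * 'C(n, v)%:R :> R.
Proof.
move=> vm vN; rewrite !pochhammer_oppn -(bin_ffact n v) natrM.
have N0 : (N ^_ v)%:R != 0 :> R by rewrite pnatr_eq0 -lt0n ffact_gt0.
have f0 : v`!%:R != 0 :> R by rewrite pnatr_eq0 -lt0n fact_gt0.
have : 'C(N, m)%:R * (m ^_ v)%:R = (N ^_ v)%:R * 'C(N - v, m - v)%:R :> R.
  by rewrite -!natrM bin_mul_ffact.
move: (m ^_ v)%:R => M CM.
have -> : 'C(N - v, m - v)%:R = 'C(N, m)%:R * M / (N ^_ v)%:R :> R.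
  by apply: (canRL (mulfK N0)); rewrite CM mulrC.
by field; rewrite N0 f0 expf_neq0 // oppr_eq0 oner_neq0.
Qed.

Lemma coef_expD_expD (R : fieldType) (l t : R) (n v : nat) :
  l != 0 -> t != 0 -> (v <= n)%N ->
  (('X + (l * t)%:P) ^+ n * ('X + t%:P) ^+ n)`_v
  = l ^+ n * t ^+ (2 * n - v) *
    \sum_(i < v.+1) 'C(n, i)%:R * 'C(n, v - i)%:R * l^-1 ^+ i.
Proof.
move=> l0 t0 vn.
have cE (a : R) i : (i <= n)%N ->
    (('X + a%:P) ^+ n)`_i = 'C(n, i)%:R * a ^+ (n - i).
  move=> i_n; rewrite addrC exprDn.
  under eq_bigr => s _ do rewrite -polyC_exp mul_polyC scalerMnl.
  rewrite -(poly_def n.+1 (fun s => a ^+ (n - s) *+ 'C(n, s))) coef_poly.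
  by rewrite ltnS i_n mulr_natl.
rewrite coefM mulr_sumr; apply: eq_bigr => i _.
have iv : (i <= v)%N by rewrite -ltnS.
have i_n := leq_trans iv vn.
rewrite !cE //; last by lia.
have -> : l ^+ n = l ^+ (n - i) * l ^+ i by rewrite -exprD subnK.
rewrite exprMn exprVn.
have -> : (2 * n - v = (n - i) + (n - (v - i)))%N by lia.
by rewrite exprD; field; rewrite expf_neq0.
Qed.

(** * Components of top total degree *)

(** The substitution j := 0, k := x T.  Only the part of the coefficient that
    is free of j is wanted. *)
Definition weight_jk {R : comNzRingType} :
    {rmorphism polyjk R -> {poly {poly R}}} :=
  horner_eval ('X%:P * 'X) \o map_poly (polyC \o polyC) \o horner_eval 0.

(** The substitution d := T, j := 0, k := x T, with values in R[x][T].  The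
    exponent of T records the total degree in d and k, and the exponent of x
    the degree in k. *)
Definition weight {R : comNzRingType} :
    {rmorphism polydjk R -> {poly {poly R}}} :=
  horner_eval 'X \o map_poly weight_jk.

Lemma weight_jkE (R : comNzRingType) (u : polyjk R) :
  weight_jk u = (map_poly (polyC \o polyC) u.[0]).['X%:P * 'X].
Proof. by []. Qed.

Lemma weightE (R : comNzRingType) (p : polydjk R) :
  weight p = (map_poly weight_jk p).['X].
Proof. by []. Qed.

Lemma weight_d (R : comNzRingType) : weight ('X : polydjk R) = 'X.
Proof. by rewrite weightE map_polyX hornerX. Qed.

Lemma weight_polyC (R : comNzRingType) (u : polyjk R) :
  weight u%:P = weight_jk u.
Proof. by rewrite weightE map_polyC hornerC. Qed.

Lemma weight_j (R : comNzRingType) : weight ('X%:P : polydjk R) = 0.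
Proof. by rewrite weight_polyC weight_jkE hornerX rmorph0 horner0. Qed.

Lemma weight_k (R : comNzRingType) : weight ('X%:P%:P : polydjk R) = 'X%:P * 'X.
Proof. by rewrite weight_polyC weight_jkE hornerC map_polyX hornerX. Qed.

Lemma weight_cst (R : comNzRingType) (c : R) : weight (c%:P%:P%:P) = c%:P%:P.
Proof.
by rewrite weight_polyC weight_jkE hornerC map_polyC hornerC.
Qed.

Lemma coef_weight_jk (R : comNzRingType) (u : polyjk R) a s :
  (weight_jk u)`_a`_s = if s == a then u`_0`_a else 0.
Proof.
rewrite weight_jkE horner_coef0; elim/poly_ind: (u`_0) a s => [|w c IH] a s.
  by rewrite rmorph0 horner0 !coef0 if_same.
rewrite rmorphD rmorphM /= map_polyX map_polyC hornerMXaddC /=.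
rewrite mulrA coefD coefMX coefC [in RHS]coefD [in RHS]coefMX [in RHS]coefC.
case: a => [|a] /=; first by rewrite !add0r coefC.
rewrite !addr0 coefMC coefMX.
by case: s => [|s] //=; rewrite IH eqSS.
Qed.

(** The coefficient of T^e collects the monomials of total degree e, so that a
    bound on the degree in d becomes divisibility by a power of x. *)
Lemma coef_weight (R : comNzRingType) (p : polydjk R) e s :
  (weight p)`_e`_s = if (s <= e)%N then p`_(e - s)`_0`_s else 0.
Proof.
elim/poly_ind: p e s => [|p c IH] e s; first by rewrite rmorph0 !coef0 if_same.
rewrite rmorphD rmorphM weight_d weight_polyC !coefD coef_weight_jk coefMX.
rewrite coefMX coefC.
case: e => [|e] /=; first by rewrite leqn0 !coef0 !add0r; case: eqP => // ->.
rewrite IH subn_eq0; case: (ltngtP s e.+1) => [lt|gt|->] /=.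
- by rewrite -ltnS lt !coef0 !addr0 subSn.
- by rewrite addr0 leqNgt (ltnW gt).
- by rewrite ltnn !coef0.
Qed.

(** [N] is a bound on the degree and [s] may vanish: unlike [lead_coef], this
    is stable under products without any nonvanishing condition. *)
Definition top_coef {A : nzRingType} (N : nat) (p : {poly A}) (s : A) : Prop :=
  (size p <= N.+1)%N /\ p`_N = s.

Lemma top_coefM (A : nzRingType) N M (p q : {poly A}) s t :
  top_coef N p s -> top_coef M q t -> top_coef (N + M) (p * q) (s * t).
Proof.
move=> [sp <-] [sq <-]; split.
  by apply: leq_trans (size_polyMleq _ _) _; lia.
have NM : (N < (N + M).+1)%N by lia.
rewrite coefM (bigD1 (Ordinal NM)) //= addKn big1 ?addr0 // => i iN.
have {iN} : (i : nat) != N by apply: contra iN => /eqP e; apply/eqP/val_inj.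
rewrite neq_ltn => /orP[lt|gt].
  have sqi : (size q <= N + M - i)%N by have := ltn_ord i; lia.
  by rewrite (nth_default _ sqi) mulr0.
by rewrite nth_default ?mul0r // (leq_trans sp).
Qed.

Lemma top_coef_linear (A : comNzRingType) (s c : A) :
  top_coef 1 (s%:P * 'X + c%:P) s.
Proof.
split; last by rewrite coefD coefMX !coefC addr0.
apply: leq_trans (size_polyD _ _) _; rewrite geq_max.
rewrite (leq_trans (size_polyC_leq1 _)) // andbT.
by apply: leq_trans (size_polyMleq _ _) _; rewrite size_polyX addn2
  size_polyC /= ltnS leq_b1.
Qed.

Lemma top_coef_pochhammer (A : comNzRingType) (s c : A) N :
  top_coef N (pochhammer (s%:P * 'X + c%:P) N) (s ^+ N).
Proof.
rewrite /pochhammer; elim: N => [|N IH].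
  by rewrite big_ord0; split; rewrite ?size_poly1 // coef1.
rewrite big_ord_recr exprSr /= -[X in top_coef X]addn1 -addrA.
rewrite -polyC_natr -polyCD.
exact: top_coefM IH (top_coef_linear _ _).
Qed.

Lemma rmorph_pochhammer (A B : nzRingType) (f : {rmorphism A -> B}) x N :
  f (pochhammer x N) = pochhammer (f x) N.
Proof.
by rewrite rmorph_prod; apply: eq_bigr => i _; rewrite rmorphD rmorph_nat.
Qed.

(** A remainder of d-degree less than e contributes to the total degree N + e
    only monomials in which k has exponent greater than N.  Hence, modulo
    x^(N+1), the components of degree N + e of p and of q * g agree, and that
    of q * g is the product of the top components as soon as N bounds the
    degree of [weight q].  Division by (1 + x)^K then gives the N-th component
    of [weight q] in every degree at most N.  Such a component has no others,
    so one with N > f would vanish, as it comes from a zero component of p: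
    f itself bounds the degree. *)
Lemma coef_div_weight (R : fieldType) (p q g r : polydjk R)
    (a : R) (K e f m : nat) (s : {poly R}) :
  p = q * g + r -> (size r <= e)%N -> a != 0 ->
  top_coef e (weight g) (a *: (1 + 'X) ^+ K) ->
  top_coef (f + e) (weight p) s -> (m <= f)%N ->
  a * (weight q)`_f`_m = coef_div K m s.
Proof.
move=> pE sr a0 [gs gt] [ps pt].
have quotient N i : (i <= N)%N -> (size (weight q) <= N.+1)%N ->
    a * (weight q)`_N`_i = coef_div K i (weight p)`_(N + e).
  move=> iN sq; rewrite -coefZ -(coef_div_exp K) -scalerAr scalerAl -gt mulrC.
  have [_ <-] := top_coefM (conj sq erefl) (conj gs erefl).
  apply: eq_coef_div => v vi; rewrite pE rmorphD rmorphM !coefD coef_weight.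
  rewrite ifT; last by lia.
  have re : (size r <= N + e - v)%N by lia.
  by rewrite (nth_default _ re) !coef0 addr0.
move=> mf; rewrite quotient ?pt //.
rewrite leqNgt; apply/negP=> fq.
have q0 : (0 < size (weight q))%N by lia.
have : lead_coef (weight q) != 0 by rewrite lead_coef_eq0 -size_poly_gt0.
rewrite lead_coefE; case sE : (size _) q0 fq => [|N] //= _ fN /eqP; apply.
apply/polyP => i; rewrite coef0; have [iN|Ni] := leqP i N; last first.
  by rewrite coef_weight leqNgt Ni.
apply: (mulfI a0); rewrite mulr0 quotient ?sE //.
rewrite (nth_default _ (_ : _ <= N + e)%N).
  by rewrite /coef_div big1 // => v _; rewrite coef0 mul0r.
by rewrite (leq_trans ps); lia.
Qed.

(** * The coefficient as a binomial expansion *)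

Lemma top_coef_weight_P (R : realType) (lambda theta : R) (n h : nat) :
  top_coef (2 * n + 2 * h + 2) (weight (P_poly lambda theta n h))
    ((1 - theta) ^+ h *:
      (('X + (lambda * theta)%:P) ^+ n * ('X + theta%:P) ^+ n)).
Proof.
rewrite /P_poly.
move: (weight_d R) (weight_j R) (weight_k R) (@weight_cst R).
(* only the values of the morphism on d, j, k and on constants matter *)
move: (@weight R) => f fd fj fk fc.
rewrite !(rmorphM f) !(rmorph_pochhammer f).
have f1 : f ('X - 2%:R * 'X%:P - 1) = 1%:P * 'X + (-1)%:P.
  by rewrite !rmorphB rmorphM rmorph1 fd fj mulr0 subr0 mul1r polyCN.
have f2 : f ('X + (2 * h)%:R - 2%:R * 'X%:P - 1)
    = 1%:P * 'X + ((2 * h)%:R - 1)%:P.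
  rewrite !rmorphB rmorphD rmorph_nat rmorphM fd fj mulr0 subr0 mul1r.
  by rewrite rmorph1 rmorph_nat addrA.
have f3 : f ('X - 'X%:P) = 1%:P * 'X + 0%:P.
  by rewrite rmorphB fd fj mul1r subr0 addr0.
have f4 : f ((1 - theta)%:P%:P%:P * 'X - 'X%:P) = (1 - theta)%:P%:P * 'X + 0%:P.
  by rewrite rmorphB rmorphM fc fd fj subr0 addr0.
have f5 a : f (a%:P%:P%:P * 'X + h%:R - n%:R - 'X%:P + 'X%:P%:P)
    = ('X + a%:P)%:P * 'X + (h%:R - n%:R)%:P.
  rewrite rmorphD !rmorphB rmorphD rmorphM !rmorph_nat fc fd fj fk.
  by rewrite subr0 !polyCD; ring.
rewrite f1 f2 f3 f4 !f5.
have L := @top_coef_linear {poly R}; have Q := @top_coef_pochhammer {poly R}.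
have -> : (2 * n + 2 * h + 2 = 1 + 1 + h + h + n + n)%N by lia.
rewrite -mul_polyC polyC_exp mulrA.
(* the factors 1 are the top coefficients of the first three factors of P *)
have -> : (1 - theta)%:P ^+ h = 1 * 1 * 1 ^+ h * (1 - theta)%:P ^+ h.
  by rewrite expr1n !mul1r.
exact: top_coefM (top_coefM (top_coefM (top_coefM (top_coefM
  (L _ _) (L _ _)) (Q _ _ _)) (Q _ _ _)) (Q _ _ _)) (Q _ _ _).
Qed.

Lemma top_coef_weight_D (R : realType) (lambda theta : R) (n h : nat) :
  top_coef (n + 2 * h + 3) (weight (D_poly lambda theta n h 0))
    ((lambda * theta ^+ h.+1) *: (1 + 'X) ^+ (n + h + 1)).
Proof.
rewrite /D_poly.
move: (weight_d R) (weight_j R) (weight_k R) (@weight_cst R).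
(* only the values of the morphism on d, j, k and on constants matter *)
move: (@weight R) => f fd fj fk fc.
rewrite !(rmorphM f) !(rmorph_pochhammer f) (rmorphXn f) expr1.
have f1 : f ((lambda * theta)%:P%:P%:P) * f 'X
    = (lambda * theta)%:P%:P * 'X + 0%:P.
  by rewrite fc fd addr0.
have f2 : f ('X + h%:R - 2%:R * 'X%:P - 1) = 1%:P * 'X + (h%:R - 1)%:P.
  rewrite !rmorphB rmorphD rmorph_nat rmorphM fd fj mulr0 subr0 mul1r.
  by rewrite rmorph1 rmorph_nat addrA.
have f3 : f (theta%:P%:P%:P * 'X - 'X%:P) = theta%:P%:P * 'X + 0%:P.
  by rewrite rmorphB rmorphM fc fd fj subr0 addr0.
have f4 : f ('X - n%:R + h%:R - 2%:R * 'X%:P - 1 + 'X%:P%:P)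
    = (1 + 'X)%:P * 'X + (h%:R - n%:R - 1)%:P.
  rewrite rmorphD !rmorphB rmorphD rmorphB rmorphM rmorph1 !rmorph_nat fd fj fk.
  by rewrite mulr0 subr0 !polyCD; ring.
rewrite f1 f2 f3 f4.
have L := @top_coef_linear {poly R}; have Q := @top_coef_pochhammer {poly R}.
have -> : (n + 2 * h + 3 = 1 + 1 + h + (n + h + 1))%N by lia.
rewrite -mul_polyC [theta ^+ _]exprS (mulrA lambda theta).
rewrite (polyCM (lambda * theta) (theta ^+ h)) polyC_exp.
rewrite -[X in X * theta%:P ^+ h]mulr1.
exact: top_coefM (top_coefM (top_coefM (L _ _) (L _ _)) (Q _ _ _)) (Q _ _ _).
Qed.

(** The degrees n - 1, n + 2h + 3 and 2n + 2h + 2 of quotient, divisor and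
    dividend add up, and c_(n,h,h-1) is the coefficient of d^(h-1) k^(n-h) in
    the quotient, a monomial of the top total degree n - 1. *)
Lemma c_coef_coef_div (R : realType) (lambda theta : R) (n h : nat) :
  lambda != 0 -> theta != 0 -> 1 - theta != 0 -> (1 <= h <= n)%N ->
  c_coef lambda theta n h (h - 1) =
  (1 - theta) ^+ h / (lambda * theta ^+ h.+1) *
  coef_div (n + h + 1) (n - h)
    (('X + (lambda * theta)%:P) ^+ n * ('X + theta%:P) ^+ n).
Proof.
move=> l0 t0 t1 /andP[h1 hn].
have k0 : lambda * theta ^+ h.+1 != 0 by rewrite mulf_neq0 ?expf_neq0.
have [PE sR] := PDE l0 t0 t1 n h 0.
rewrite (size_lead_D l0 t0 t1 n h 0).1 in sR.
have sR' : (size (P_poly lambda theta n h %% D_poly lambda theta n h 0)%R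
    <= n + 2 * h + 3)%N by lia.
have tP := top_coef_weight_P lambda theta n h.
have degP : (2 * n + 2 * h + 2 = (n - 1) + (n + 2 * h + 3))%N by lia.
rewrite degP in tP.
have mn : (n - h <= n - 1)%N by lia.
have := coef_div_weight PE sR' k0 (top_coef_weight_D lambda theta n h) tP mn.
rewrite coef_divZ => E; rewrite [RHS]mulrAC -E mulrC mulKf //.
rewrite coef_weight mn /c_coef /q_coef.
have -> : (h - (h - 1) - 1 = 0)%N by lia.
have -> : (n - 1 - (n - (h - 1) - 1) = h - 1)%N by lia.
by have -> : (n - 1 - (n - h) = h - 1)%N by lia.
Qed.

Theorem proposition5 (R : realType) (lambda theta : R)
  (hl : 0 < lambda <= 1) (ht : 0 < theta < 1) :
  (forall n h : nat, (1 <= h <= n)%N ->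
     c_coef lambda theta n h (h - 1) =
       (1 - theta) ^+ h * (lambda * theta) ^+ (n - 1) * (- theta) ^+ (n - h)
       * 'C(2 * n, n - h)%:R
       * \sum_(0 <= v < (n - h).+1)
           pochhammer (h%:R - n%:R) v * pochhammer (- n%:R) v
           / (pochhammer (- (2 * n)%:R) v * v`!%:R * theta ^+ v)
           * hyp2F1 (- v%:R) (- n%:R) (n%:R - v%:R + 1) lambda^-1)
  /\
  (forall n h : nat, (1 <= h <= n)%N ->
     c_coef 1 theta n h (h - 1) =
       (1 - theta) ^+ n * theta ^+ (n - 1) * 'C(2 * n, n - h)%:R).
Proof.
have l0 : lambda != 0 by case/andP: hl => /lt0r_neq0.
have t0 : theta != 0 by case/andP: ht => /lt0r_neq0.
have t1 : 1 - theta != 0 by rewrite subr_eq0 gt_eqF //; case/andP: ht.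
split=> n h hn; rewrite c_coef_coef_div ?oner_neq0 //;
  have /andP[h1 h_n] := hn; last first.
  rewrite !mul1r -exprD addnn -mul2n.
  have -> : (n + h + 1 = (2 * n - (n - h)).+1)%N by lia.
  rewrite coef_div_shift_exp; last by lia.
  have -> : (1 - theta) ^+ n = (1 - theta) ^+ h * (1 - theta) ^+ (n - h).
    by rewrite -exprD subnKC.
  have -> : (2 * n - (n - h) = (n - 1) + h.+1)%N by lia.
  by rewrite exprD; field; rewrite expf_neq0.
rewrite big_mkord /coef_div 2!mulr_sumr; apply: eq_bigr => v _.
have vm : (v <= n - h)%N by rewrite -ltnS.
have vn : (v <= n)%N by lia.
rewrite coef_expD_expD // -bin_mul_hyp2F1 //.
have -> : h%:R - n%:R = - (n - h)%:R :> R by rewrite natrB // opprB.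
have v2n : (v <= 2 * n)%N by lia.
have := bin_mul_pochhammer_ratio R n vm v2n.
move: (hyp2F1 _ _ _ _) (pochhammer _ v * pochhammer _ v) => F P.
move: (pochhammer _ v * v`!%:R) => D ratio.
transitivity ((1 - theta) ^+ h * (lambda * theta) ^+ (n - 1)
  * (- theta) ^+ (n - h) * ('C(2 * n, n - h)%:R * (P / D)) / theta ^+ v * F);
  last by rewrite [(D * _)^-1]invfM; ring.
rewrite ratio.
have -> : ((n + h + 1 + (n - h - v)).-1 = 2 * n - v)%N by lia.
have -> : (-1) ^+ (n - h - v) = (-1) ^+ (n - h) * (-1) ^+ v :> R.
  by rewrite -signr_odd oddB // signr_addb !signr_odd.
have -> : theta ^+ (2 * n - v) =
    theta ^+ h.+1 * theta ^+ (n - 1) * theta ^+ (n - h) / theta ^+ v.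
  apply: (canRL (mulfK (expf_neq0 v t0))); rewrite -!exprD.
  by congr (_ ^+ _); lia.
have -> : lambda ^+ n = lambda * lambda ^+ (n - 1).
  by rewrite -exprS; congr (_ ^+ _); lia.
rewrite (exprNn theta) exprMn; field.
by rewrite l0 !expf_neq0.
Qed.
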